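(* The class ${\det}_3 \in H^3(M_{3,3}(\mathbb{F}_2);\mathbb{F}_2)^{\mathrm{GL}_3(\mathbb{F}_2) \times \mathrm{GL}_3(\mathbb{F}_2)}$ lies in the image of the restriction map from $H^3(\mathrm{GL}_6(\mathbb{F}_2);\mathbb{F}_2)$.
   Context: $M_{3,3}(\mathbb{F}_2) \subset \mathrm{GL}_{6}(\mathbb{F}_2)$ is the subgroup of $(6\times 6)$-matrices of the block form $\begin{bmatrix}\mathrm{id}_3 & * \\ 0 & \mathrm{id}_3\end{bmatrix}$. It is isomorphic to the additive group of $(3\times 3)$-matrices over $\mathbb{F}_2$ and is normalised by the block-diagonal subgroup $\mathrm{GL}_3(\mathbb{F}_2)\times \mathrm{GL}_3(\mathbb{F}_2)$, which therefore acts on its cohomology; this action corresponds to left and right multiplication on $(3\times 3)$-matrices. The cohomology ring $H^*(M_{3,3}(\mathbb{F}_2);\mathbb{F}_2)$ is the polynomial algebra over $\mathbb{F}_2$ on the degree $1$ classes $x_{ij}$, $1\le i,j\le 3$, where $x_{ij}$ is the homomorphism $M_{3,3}(\mathbb{F}_2)\to\mathbb{F}_2$ recording the $(i,j)$ entry of the upper right block, and ${\det}_3 := \det(x_{ij})$, an invariant class of degree $3$. *)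

(* Defs.v *)
From HB Require Import structures.
From mathcomp Require Import all_boot all_order all_fingroup all_algebra.

Set Implicit Arguments.
Unset Strict Implicit.
Unset Printing Implicit Defensive.

Import GRing.Theory.
Local Open Scope ring_scope.
Local Open Scope quotient_scope.

(* Cohomology of a finite group gT with coefficients in the trivial module F, *)
(* computed by the inhomogeneous bar complex.                                 *)
Section Cohomology.

Variables (F : fieldType) (gT : finGroupType).

Definition cochain (n : nat) : vectType F := {ffun {ffun 'I_n -> gT} -> F^o}.

(* For 0 < i < n.+1 the i-th face multiplies the adjacent entries of index    *)
(* i.-1 and i; the 0-th face drops the first entry, the n.+1-st the last one. *)
Definition face n (i : nat) (g : {ffun 'I_n.+1 -> gT}) : {ffun 'I_n -> gT} :=
  [ffun j : 'I_n =>
     if (j.+1 < i)%N then g (widen_ord (leqnSn n) j)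
     else if (j.+1 == i)%N then (g (widen_ord (leqnSn n) j) * g (lift ord0 j))%g
     else g (lift ord0 j)].

Definition cobound n (c : cochain n) : cochain n.+1 :=
  [ffun g => \sum_(i < n.+2) (-1) ^+ i *: c (face i g)].

Fact cobound_is_linear n : linear (@cobound n).
Proof.
move=> a u v; apply/ffunP=> g; rewrite !ffunE scaler_sumr -big_split /=.
by apply: eq_bigr => i _; rewrite !ffunE scalerDr !scalerA mulrC.
Qed.
HB.instance Definition _ n :=
  GRing.isLinear.Build F (cochain n) (cochain n.+1) *:%R (@cobound n)
    (@cobound_is_linear n).

Definition cocycles n : {vspace cochain n} := lker (linfun (@cobound n)).

Definition coboundaries n : {vspace cochain n} :=
  if n is m.+1 then limg (linfun (@cobound m)) else 0%VS.

Definition cocycle n := subvs_of (cocycles n).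

Definition exact_cocycles n : {vspace cocycle n} :=
  (linfun vsval @^-1: coboundaries n)%VS.

Definition cohomology n : zmodType :=
  Quotient.quot (pred_of_vspace (exact_cocycles n)).

Definition cclass n (z : cocycle n) : cohomology n := \pi z.

Lemma cocycleP n (c : cochain n) :
  reflect (cobound c = 0) (c \in cocycles n).
Proof. by rewrite memv_ker lfunE; apply: eqP. Qed.

Lemma coboundP n (z : cocycle n) : cobound (vsval z) = 0.
Proof. exact/cocycleP/subvsP. Qed.

Lemma cclass_eq n (y z : cocycle n) :
  (cclass y == cclass z) = (vsval y - vsval z \in coboundaries n).
Proof. by rewrite -Quotient.idealrBE -memv_preim lfunE. Qed.

Lemma cclass_repr n (z : cocycle n) :
  vsval (generic_quotient.repr (cclass z)) - vsval z \in coboundaries n.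
Proof. by rewrite -cclass_eq /cclass reprK. Qed.

Lemma cclassB n : {morph @cclass n : y z / y - z}.
Proof. exact: raddfB. Qed.

Lemma cobound_in n (c : cochain n) : cobound c \in coboundaries n.+1.
Proof. by rewrite -[cobound c](lfunE (@cobound n)) memv_img ?memvf. Qed.

Lemma coboundariesP n (c : cochain n.+1) :
  reflect (exists b, c = cobound b) (c \in coboundaries n.+1).
Proof.
apply: (iffP idP) => [/memv_imgP[b _]|[b ->]]; last exact: cobound_in.
by rewrite lfunE; exists b.
Qed.

Definition cup_cochain m n (a : cochain m) (b : cochain n) : cochain (m + n) :=
  [ffun g : {ffun 'I_(m + n) -> gT} =>
     (a [ffun i => g (lshift n i)] : F) * (b [ffun i => g (rshift m i)] : F)].

Lemma cup_cochain0l m n (b : cochain n) : cup_cochain (0 : cochain m) b = 0.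
Proof. by apply/ffunP=> g; rewrite !ffunE mul0r. Qed.

Lemma cup_cochain0r m n (a : cochain m) : cup_cochain a (0 : cochain n) = 0.
Proof. by apply/ffunP=> g; rewrite !ffunE mulr0. Qed.

Lemma cobound_cup m n (a : cochain m) (b : cochain n)
    (g : {ffun 'I_(m + n).+1 -> gT}) :
  cobound (cup_cochain a b) g =
    cup_cochain (cobound a) b g
    + (-1) ^+ m * cup_cochain a (cobound b)
        [ffun i => g (cast_ord (addnS m n) i)].
Proof.
rewrite [LHS]ffunE.
have -> : (m + n).+2 = (m.+1 + n.+1)%N by rewrite addSn addnS.
rewrite big_split_ord /= 2!ffunE [in RHS]ffunE [cobound b _]ffunE.
rewrite (big_ord_recr m.+1) /= [in X in _ = _ + X]big_ord_recl.
rewrite mulrDl -addrA; congr (_ + _).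
  rewrite mulr_suml; apply: eq_bigr => i _; rewrite ffunE -[RHS]mulrA.
  congr (_ * (a _ * b _)); apply/ffunP=> j; rewrite !ffunE /=.
    by congr (if _ then g _ else if _ then g _ * g _ else g _)%g;
      apply: val_inj.
  have lt_i : (i < (m + j).+1)%N.
    by rewrite (leq_trans (ltn_ord i)) // ltnS leq_addr.
  rewrite ltnNge ltnW //= gtn_eqF //.
  by congr (g _); apply: val_inj.
rewrite mulrDr mulrDr addrA /= [X in _ = X + _](_ : _ = 0) ?add0r.
  rewrite !mulr_sumr; apply: eq_bigr => i _; rewrite ffunE /=.
  rewrite [RHS](_ : _ = (-1) ^+ (m.+1 + i) *:
      (a [ffun i0 => [ffun i1 => g (cast_ord (addnS m n) i1)] (lshift n.+1 i0)] *
       b (face i.+1 [ffun i0 => [ffun i1 => g (cast_ord (addnS m n) i1)]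
                                  (rshift m i0)]) : F^o)); last first.
    by rewrite addSnnS exprD -scalerA; congr (_ * _); exact: mulrCA.
  congr (_ * (a _ * b _)); apply/ffunP=> j; rewrite !ffunE /=.
    by rewrite ltn_addr ?ltnS //; congr (g _); exact: val_inj.
  rewrite -(addnS m j) (addSnnS m i) ltn_add2l eqn_add2l.
  by congr (if _ then g _ else if _ then g _ * g _ else g _)%g;
    apply: val_inj; rewrite //= /bump /= ?addnS.
have -> : face m.+1 [ffun i : 'I_m.+1 => g (lshift n i)] =
    [ffun i => [ffun i0 => g (cast_ord (addnS m n) i0)] (lshift n.+1 i)].
  apply/ffunP=> j; rewrite !ffunE ltnS ltn_ord; congr (g _); exact: val_inj.
have -> : face 0 [ffun i => [ffun i0 => g (cast_ord (addnS m n) i0)]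
                              (rshift m i)] = [ffun i : 'I_n => g (rshift m.+1 i)].
  apply/ffunP=> j; rewrite !ffunE; congr (g _); apply: val_inj.
  by rewrite /= /bump /= add1n addnS.
move: (a _) (b _) => x y; rewrite expr0 scale1r exprS mulN1r scaleNr mulNr.
by rewrite mulrA addNr.
Qed.

Fact cup_cocycle_subproof m n (y : cocycle m) (z : cocycle n) :
  cup_cochain (vsval y) (vsval z) \in cocycles (m + n).
Proof.
apply/cocycleP/ffunP=> g; rewrite cobound_cup !coboundP.
by rewrite cup_cochain0l cup_cochain0r !ffunE mulr0 addr0.
Qed.

Definition cup_cocycle m n (y : cocycle m) (z : cocycle n) : cocycle (m + n) :=
  Subvs (cup_cocycle_subproof y z).

(* Independent of the chosen representatives by cup_cclass.                   *)
Definition cup m n (x : cohomology m) (y : cohomology n) : cohomology (m + n) :=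
  cclass (cup_cocycle (generic_quotient.repr x) (generic_quotient.repr y)).

Lemma cobound_cast_in k l (e : k.+1 = l) (c : cochain k) :
  [ffun g : {ffun 'I_l -> gT} => cobound c [ffun i => g (cast_ord e i)]]
    \in coboundaries l.
Proof.
case: l / e; suff -> : [ffun g : {ffun 'I_k.+1 -> gT} =>
    cobound c [ffun i => g (cast_ord (erefl k.+1) i)]] = cobound c.
  exact: cobound_in.
apply/ffunP=> g; rewrite ffunE; congr (cobound c _); apply/ffunP=> i.
by rewrite ffunE cast_ord_id.
Qed.

Lemma cup_coboundaries_l m n (a : cochain m) (z : cocycle n) :
  a \in coboundaries m -> cup_cochain a (vsval z) \in coboundaries (m + n).
Proof.
case: m a => [|m] a.
  by rewrite memv0 => /eqP ->; rewrite cup_cochain0l mem0v.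
case/coboundariesP=> c ->; apply/coboundariesP; exists (cup_cochain c (vsval z)).
apply/ffunP=> g; rewrite cobound_cup coboundP cup_cochain0r.
by rewrite [X in _ * X]ffunE mulr0 addr0.
Qed.

Lemma cup_coboundaries_r m n (y : cocycle m) (b : cochain n) :
  b \in coboundaries n -> cup_cochain (vsval y) b \in coboundaries (m + n).
Proof.
case: n b => [|n] b.
  by rewrite memv0 => /eqP ->; rewrite cup_cochain0r mem0v.
case/coboundariesP=> c ->.
have -> : cup_cochain (vsval y) (cobound c) =
    [ffun g : {ffun _ -> gT} => cobound ((-1) ^+ m *: cup_cochain (vsval y) c)
                 [ffun i => g (cast_ord (esym (addnS m n)) i)]].
  apply/ffunP=> g; rewrite [RHS]ffunE linearZ.
  rewrite [RHS](ffunE _ _ : _ = (-1) ^+ m * cobound _ _) cobound_cup coboundP.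
  rewrite cup_cochain0l [X in _ * (X + _)]ffunE add0r [RHS]mulrA -exprD.
  rewrite addnn -mul2n exprM sqrrN expr1n expr1n mul1r.
  by congr (cup_cochain _ _ _); apply/ffunP=> i; rewrite !ffunE cast_ordK.
exact: cobound_cast_in.
Qed.

Lemma cup_cclass m n (y : cocycle m) (z : cocycle n) :
  cup (cclass y) (cclass z) = cclass (cup_cocycle y z).
Proof.
apply/eqP; rewrite cclass_eq /=.
set y' := generic_quotient.repr _; set z' := generic_quotient.repr _.
have -> : cup_cochain (vsval y') (vsval z') - cup_cochain (vsval y) (vsval z)
    = cup_cochain (vsval y' - vsval y) (vsval z')
      + cup_cochain (vsval y) (vsval z' - vsval z).
  by apply/ffunP=> g; rewrite !ffunE mulrBl mulrBr addrA subrK.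
by rewrite memvD ?cup_coboundaries_l ?cup_coboundaries_r // cclass_repr.
Qed.

Fact hom_cocycle_subproof (f : gT -> F) :
  {morph f : x y / (x * y)%g >-> x + y} ->
  ([ffun g : {ffun 'I_1 -> gT} => f (g ord0)] : cochain 1) \in cocycles 1.
Proof.
move=> fM; apply/cocycleP/ffunP=> g.
rewrite !ffunE !big_ord_recl big_ord0 !ffunE /= fM.
rewrite expr0 expr1 expr2 mulrNN mulr1 !scale1r scaleN1r addr0 opprD.
by rewrite addrAC addNr add0r addrN.
Qed.

Definition hom_class (f : gT -> F)
    (fM : {morph f : x y / (x * y)%g >-> x + y}) : cohomology 1 :=
  cclass (Subvs (hom_cocycle_subproof fM)).

End Cohomology.

Section Pullback.

Variables (F : fieldType) (aT rT : finGroupType).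
Variable f : {multiplicative aT -> rT}.

Definition pullback_cochain n (c : cochain F rT n) : cochain F aT n :=
  [ffun g : {ffun 'I_n -> aT} => c [ffun i => f (g i)]].

Lemma pullback_cochain0 n : pullback_cochain (0 : cochain F rT n) = 0.
Proof. by apply/ffunP=> g; rewrite !ffunE. Qed.

Lemma cobound_pullback n (c : cochain F rT n) :
  cobound (pullback_cochain c) = pullback_cochain (cobound c).
Proof.
apply/ffunP=> g; rewrite !ffunE; apply: eq_bigr => i _; rewrite ffunE.
congr (_ *: c _); apply/ffunP=> j; rewrite !ffunE.
by case: ifP => // _; case: ifP; rewrite ?gmulfM.
Qed.

Lemma pullback_coboundaries n (c : cochain F rT n) :
  c \in coboundaries F rT n -> pullback_cochain c \in coboundaries F aT n.
Proof.
case: n c => [|n] c; last first.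
  case/coboundariesP=> b ->; apply/coboundariesP; exists (pullback_cochain b).
  by rewrite cobound_pullback.
by rewrite memv0 => /eqP ->; rewrite pullback_cochain0 mem0v.
Qed.

Fact pullback_cocycle_subproof n (z : cocycle F rT n) :
  pullback_cochain (vsval z) \in cocycles F aT n.
Proof.
by apply/cocycleP; rewrite cobound_pullback coboundP pullback_cochain0.
Qed.

Definition pullback_cocycle n (z : cocycle F rT n) : cocycle F aT n :=
  Subvs (pullback_cocycle_subproof z).

(* Independent of the chosen representative by pullback_cclass.               *)
Definition pullback n (x : cohomology F rT n) : cohomology F aT n :=
  cclass (pullback_cocycle (generic_quotient.repr x)).

Lemma pullback_cclass n (z : cocycle F rT n) :
  pullback (cclass z) = cclass (pullback_cocycle z).
Proof.
apply/eqP; rewrite cclass_eq /=; set z' := generic_quotient.repr _.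
have -> : pullback_cochain (vsval z') - pullback_cochain (vsval z)
    = pullback_cochain (vsval z' - vsval z).
  by apply/ffunP=> g; rewrite !ffunE.
exact/pullback_coboundaries/cclass_repr.
Qed.

End Pullback.

HB.instance Definition _ (gT : finGroupType) (G : {group gT}) :=
  isMultiplicative.Build (subg_of G) gT sgval (fun x y => erefl).

Definition restriction (F : fieldType) (gT : finGroupType) (G : {group gT}) n
    (c : cohomology F gT n) : cohomology F (subg_of G) n :=
  pullback (sgval : {multiplicative subg_of G -> gT}) c.

Section M33.

Local Notation F2 := ('F_2).
Local Notation GL6 := ({'GL_6['F_2]}).
Local Notation GL3 := ({'GL_3['F_2]}).

Definition unip (g : GL6) (X : 'M[F2]_3) :=
  GLval g == block_mx 1%:M X 0 1%:M :> 'M_(3 + 3).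

Definition M33 : {set GL6} := [set g | [exists X, unip g X]].

Lemma M33P (g : GL6) : reflect (exists X, unip g X) (g \in M33).
Proof. by rewrite inE; apply: existsP. Qed.

Lemma unipM (g h : GL6) X Y : unip g X -> unip h Y -> unip (g * h) (X + Y).
Proof.
rewrite /unip => /eqP gE /eqP hE.
rewrite [X in X == _](GL_MxE g h : _ = (_ : 'M_(3 + 3)) *m (_ : 'M_(3 + 3))).
rewrite gE hE mulmx_block !mulmx0 !mul0mx !mul1mx !mulmx1 !addr0 !add0r.
by rewrite addrC.
Qed.

Fact M33_group_set : group_set M33.
Proof.
apply/group_setP; split=> [|g h /M33P[X gX] /M33P[Y hY]].
  by apply/M33P; exists 0; rewrite /unip GL_1E -scalar_mx_block.
by apply/M33P; exists (X + Y); apply: unipM.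
Qed.
Canonical M33_group := Group M33_group_set.

Definition entry (i j : 'I_3) (g : subg_of M33_group) : F2 :=
  @ursubmx _ 3 3 3 3 (GLval (sgval g)) i j.

Lemma unip_ur (g : GL6) X : unip g X -> @ursubmx _ 3 3 3 3 (GLval g) = X.
Proof. by move=> /eqP ->; rewrite block_mxKur. Qed.

Lemma entryM i j : {morph entry i j : x y / (x * y)%g >-> x + y}.
Proof.
move=> x y; rewrite /entry.
have /M33P[X xX] := subgP x; have /M33P[Y yY] := subgP y.
by rewrite (unip_ur (unipM xX yY)) (unip_ur xX) (unip_ur yY) mxE.
Qed.

Definition xclass (i j : 'I_3) : cohomology F2 (subg_of M33_group) 1 :=
  hom_class (entryM i j).

(* The Leibniz expansion of det (x_ij), with products the cup product; it is  *)
(* independent of the order of the factors since cohomology over 'F_2 is      *)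
(* commutative.                                                               *)
Definition det3 : cohomology F2 (subg_of M33_group) 3 :=
  \sum_(s : 'S_3)
    cup (xclass 0 (s 0)) (cup (xclass 1 (s 1)) (xclass 2 (s 2))) *~ (-1) ^+ s.

Fact block_diag_unit (A B : GL3) :
  (block_mx (GLval A) 0 0 (GLval B) : 'M_6) \is a GRing.unit.
Proof.
suff: (block_mx (GLval A) 0 0 (GLval B) : 'M_(3 + 3)) \in unitmx by [].
rewrite unitmxE det_ublock unitrM -!unitmxE.
by apply/andP; split; [exact: (GL_unit A) | exact: (GL_unit B)].
Qed.

Definition block_diag (A B : GL3) : GL6 := FinRing.Unit (block_diag_unit A B).

Lemma unip_conj (A B : GL3) (g : GL6) X : unip g X ->
  unip (g ^ block_diag A B)%g (GLval A^-1 *m X *m GLval B).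
Proof.
set Y := _ *m _ *m _ => gX; pose h : 'M[F2]_(3 + 3) := block_mx 1%:M Y 0 1%:M.
have hU : (h : 'M_6) \is a GRing.unit.
  suff: h \in unitmx by [].
  by rewrite unitmxE det_ublock !det1 mulr1 unitr1.
suff -> : (g ^ block_diag A B)%g = FinRing.Unit hU by rewrite /unip.
apply: (mulgI (block_diag A B)); rewrite -conjgC; apply: val_inj.
move/eqP: gX => gX.
transitivity ((GLval g : 'M_(3 + 3)) *m block_mx (GLval A) 0 0 (GLval B)) => //.
transitivity (block_mx (GLval A) 0 0 (GLval B) *m h) => //.
rewrite gX !mulmx_block !mulmx0 !mul0mx !mul1mx !mulmx1 !addr0 !add0r.
suff -> : X *m GLval B = GLval A *m Y by [].
have AV : GLval A *m GLval A^-1 = 1%:M by rewrite -GL_MxE mulgV.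
by rewrite /Y !mulmxA AV mul1mx.
Qed.

Fact block_conj_subproof (A B : GL3) (x : subg_of M33_group) :
  (sgval x ^ block_diag A B)%g \in M33_group.
Proof.
have /M33P[X xX] := subgP x.
by apply/M33P; exists (GLval A^-1 *m X *m GLval B); apply: unip_conj.
Qed.

Definition block_conj (A B : GL3) (x : subg_of M33_group) : subg_of M33_group :=
  Subg (block_conj_subproof A B x).

Fact block_conjM A B : {morph block_conj A B : x y / (x * y)%g}.
Proof. by move=> x y; apply: val_inj; exact: conjMg. Qed.
HB.instance Definition _ (A B : GL3) :=
  isMultiplicative.Build (subg_of M33_group) (subg_of M33_group)
    (block_conj A B) (block_conjM A B).

Lemma entry_block_conj A B x i j :
  entry i j (block_conj A B x) =
    (GLval A^-1 *m \matrix_(k, l) entry k l x *m GLval B) i j.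
Proof.
have /M33P[X xX] := subgP x; rewrite {1}/entry (unip_ur (unip_conj A B xX)).
by congr ((_ *m _ *m _) i j); apply/matrixP=> k l; rewrite mxE /entry (unip_ur xX).
Qed.

(* block_conj A B maps the unipotent with upper right block X to the one with *)
(* block A^-1 *m X *m B (unip_conj), so pullback makes GL3 x GL3 act on the   *)
(* left on cohomology.                                                        *)
Definition block_invariants n : {pred cohomology F2 (subg_of M33_group) n} :=
  [pred c | [forall A, forall B, pullback (block_conj A B) c == c]].

End M33.

Arguments block_invariants n : clear implicits.

(* Main.v *)
Require Import Defs.
From mathcomp Require Import all_boot all_order all_fingroup all_algebra.
From mathcomp Require Import ring.

(** Write M for the group of block unipotent matrices, G for GL_6(F_2) and U
    for the group of upper unitriangular matrices of size 6, a Sylow 2-subgroup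
    of G containing M.

    The lift of det_3 to G is the transfer from U to G of a class y on U that
    restricts to det_3 on M.  By the double coset formula the restriction to M
    of a transfer from U is a sum over the orbits of M on the set of cosets
    U\G.  An orbit that is not a point contributes a transfer to M from a proper
    subgroup; M is elementary abelian, so this contribution is zero, and with
    well chosen coset representatives it already vanishes on cochains, the
    terms cancelling in pairs (transfer_restrict).  A coset Ux fixed by M
    satisfies x M x^-1 <= U, which forces x to be block upper triangular, so
    that conjugation by x acts on M through GL_3 x GL_3 (conj_M_U6).  As det_3
    is invariant (det3_invariant), each fixed coset contributes det_3.  The
    cosets that are moved come in pairs and the index of U in G is odd, so the
    number of fixed cosets is odd (card_fixed_cosets) and the sum is det_3.

    There remains the class y.  A unitriangular g has a top left block A, a top
    right block with columns c, d, e and a bottom right block.  Over F_2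
    the cochain det(c(g), A(g) d(h), A(g) A(h) e(k)) represents det_3 on M, and
    it is a cocycle on the subgroup where the bottom right block is trivial,
    being a cup product of crossed homomorphisms.  In general it has to be
    corrected by terms that vanish on M.  They can be chosen so that the result
    is still linear in the last column of k, which makes it the cup product of
    the crossed homomorphism given by the last column with a 2-cocycle of the
    unitriangular group of size 5 whose values are row vectors of length 5.
    The terms in det_cocycle are a solution of the linear system that the
    cocycle identity imposes on the coefficients of such corrections.  The
    identity itself is one between Boolean polynomials in the matrix entries of
    four group elements, and it is checked by normalization
    (generic_cobound_null).

    Invariance of det_3 is the multiplicativity of the determinant, for the
    symmetric trilinear map given by the triple cup product of degree one
    classes (symdet_mull). *)

Set Implicit Arguments.
Unset Strict Implicit.
Unset Printing Implicit Defensive.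

Import GRing.Theory.
Local Open Scope group_scope.
Local Open Scope ring_scope.

(** * Arithmetic modulo two *)

Lemma F2_addxx (x : 'F_2) : x + x = 0.
Proof. by apply: val_inj; case: x => [[|[|]]]. Qed.

Lemma F2_mulxx (x : 'F_2) : x * x = x.
Proof. by apply: val_inj; case: x => [[|[|]]]. Qed.

Lemma F2_opp (x : 'F_2) : - x = x.
Proof. by apply: (addrI x); rewrite subrr F2_addxx. Qed.

(** * Transfer of inhomogeneous cochains *)

Section PartialProducts.

Variable gT : finGroupType.

(** The vertices of a bar tuple, seen as a path that starts at 1; a function on all
    of nat, so that inductions along the path need no bound. *)
Definition pprod n (g : {ffun 'I_n -> gT}) (i : nat) : gT :=
  \prod_(0 <= k < i) (if insub k is Some j then g j else 1)%g.

Lemma pprod0 n (g : {ffun 'I_n -> gT}) : pprod g 0 = 1%g.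
Proof. by rewrite /pprod big_geq. Qed.

Lemma pprodS n (g : {ffun 'I_n -> gT}) (j : 'I_n) : pprod g j.+1 = (pprod g j * g j)%g.
Proof. by rewrite /pprod big_nat_recr //= valK. Qed.

Lemma pprod_face n (g : {ffun 'I_n.+1 -> gT}) i j : (0 < i)%N -> (j <= n)%N ->
  pprod (face i g) j = pprod g (if (j < i)%N then j else j.+1).
Proof.
move=> i_gt0; elim: j => [|j IH] lt_jn; first by rewrite i_gt0 !pprod0.
have -> : j = Ordinal lt_jn by [].
rewrite pprodS /= IH ?(ltnW lt_jn) // ffunE /=.
set j1 := widen_ord _ _; set j2 := lift _ _.
have S1 : pprod g j.+1 = (pprod g j * g j1)%g by exact: (pprodS g j1).
have S2 : pprod g j.+2 = (pprod g j.+1 * g j2)%g by exact: (pprodS g j2).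
case: (ltngtP j.+1 i) => [lt_ji|gt_ji|eq_ji].
- by rewrite S1.
- by rewrite S2.
- by rewrite S2 S1 mulgA.
Qed.

Lemma pprod_face0 n (g : {ffun 'I_n.+1 -> gT}) j : (j <= n)%N ->
  (g ord0 * pprod (face 0 g) j)%g = pprod g j.+1.
Proof.
elim: j => [|j IH] lt_jn.
  by rewrite pprod0 mulg1 -[1%N]/((ord0 : 'I_n.+1).+1) pprodS pprod0 mul1g.
have -> : j = Ordinal lt_jn by [].
rewrite pprodS /= mulgA IH ?(ltnW lt_jn) // ffunE /=.
by rewrite -(pprodS g (lift ord0 (Ordinal lt_jn))).
Qed.

Lemma pprod_group (E : {group gT}) n (g : {ffun 'I_n -> gT}) i :
  (forall j, g j \in E) -> pprod g i \in E.
Proof.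
by move=> gE; apply: group_prod => k _; case: insubP.
Qed.

End PartialProducts.

Section Transfer.

Variables (F : fieldType) (gT : finGroupType) (U : {group gT}).
Variable r : {set gT} -> gT.
Implicit Types (A : {set gT}) (x : gT).

Local Notation cosets := (rcosets U [set: gT]).

Lemma rcosets_mulg A x : A \in cosets -> A :* x \in cosets.
Proof.
by case/rcosetsP=> y _ ->; rewrite -rcosetM; apply/rcosetsP; exists (y * x)%g.
Qed.

(** The U-component of x at the coset A: right multiplication by x carries the
    representative of A to cosetcocycle A x times the representative of A :* x. *)
Definition cosetcocycle A x : gT := (r A * x * (r (A :* x))^-1)%g.

(** A bar tuple is a path in the group; this is the sequence of U-components
    met along the path in the space of cosets that starts at A. *)
Definition coset_tuple n A (g : {ffun 'I_n -> gT}) : {ffun 'I_n -> gT} :=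
  [ffun i : 'I_n => cosetcocycle (A :* pprod g i) (g i)].

Lemma cosetcocycleM A x y :
  cosetcocycle A (x * y) = (cosetcocycle A x * cosetcocycle (A :* x) y)%g.
Proof. by rewrite /cosetcocycle rcosetM !mulgA mulgKV. Qed.

Lemma coset_tuple_face n A (g : {ffun 'I_n.+1 -> gT}) i : (0 < i)%N ->
  coset_tuple A (face i g) = face i (coset_tuple A g).
Proof.
move=> i_gt0; apply/ffunP=> j; rewrite !ffunE pprod_face ?(ltnW (ltn_ord j)) //=.
case: (ltngtP j.+1 i) => [lt_ji|gt_ji|eq_ji].
- by [].
- by [].
- rewrite cosetcocycleM; congr (_ * cosetcocycle _ _)%g.
  by rewrite -rcosetM -[X in _ :* X](pprodS g (widen_ord (leqnSn n) j)).
Qed.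

(** Dropping the first entry moves the starting point of the path, whence the
    change of coset that is compensated by reindexing in cobound_transfer. *)
Lemma coset_tuple_face0 n A (g : {ffun 'I_n.+1 -> gT}) :
  coset_tuple (A :* g ord0) (face 0 g) = face 0 (coset_tuple A g).
Proof.
apply/ffunP=> j; rewrite !ffunE /= -rcosetM pprod_face0 //.
exact: ltnW.
Qed.

Definition transfer n (c : cochain F gT n) : cochain F gT n :=
  [ffun g => \sum_(A in cosets) c (coset_tuple A g)].

Lemma cobound_transfer n (c : cochain F gT n) :
  cobound (transfer c) = transfer (cobound c).
Proof.
apply/ffunP=> g; rewrite !ffunE.
under [RHS]eq_bigr do rewrite ffunE.
rewrite exchange_big; apply: eq_bigr => i _.
rewrite -scaler_sumr ffunE; congr (_ *: _).
have [i0|i_gt0] := posnP i; last by under eq_bigr do rewrite coset_tuple_face //.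
rewrite i0 (reindex_onto (fun A => A :* g ord0) (fun A => A :* (g ord0)^-1)) /=.
  apply: eq_big => [A|A _]; last by rewrite coset_tuple_face0.
  rewrite -rcosetM mulgV rcoset1 eqxx andbT.
  apply/idP/idP=> [|/rcosets_mulg -> //].
  by move/(rcosets_mulg (g ord0)^-1); rewrite -rcosetM mulgV rcoset1.
by move=> A _; rewrite -rcosetM mulVg rcoset1.
Qed.

Hypothesis rP : forall A, A \in cosets -> r A \in A.

Lemma cosetcocycle_in A x : A \in cosets -> cosetcocycle A x \in U.
Proof.
move=> AX; have := rP (rcosets_mulg x AX); have := rP AX.
rewrite /cosetcocycle; case/rcosetsP: AX => y _ ->.
rewrite -rcosetM !mem_rcoset invMg => ryU rxU.
suff -> : (r (U :* y) * x * (r (U :* (y * x)))^-1 =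
    (r (U :* y) * y^-1) * (r (U :* (y * x)) * (x^-1 * y^-1))^-1)%g.
  by rewrite groupM ?groupV.
by rewrite !invMg !invgK !mulgA mulgKV.
Qed.

(** Cochains on U are represented by cochains on the whole group, of which only
    the values on tuples in U matter. *)
Lemma transfer_cocycle n (c : cochain F gT n) :
  (forall g : {ffun 'I_n.+1 -> gT}, (forall i, g i \in U) -> cobound c g = 0) ->
  transfer c \in cocycles F gT n.
Proof.
move=> cU; apply/cocycleP; rewrite cobound_transfer; apply/ffunP=> g.
rewrite !ffunE big1 // => A AX; apply: cU => i.
by rewrite ffunE cosetcocycle_in // rcosets_mulg.
Qed.

End Transfer.

Lemma sum_involution (I : finType) (V : zmodType) (P : pred I) (h : I -> I)
    (f : I -> V) :
    (forall x : V, x + x = 0) -> involutive h ->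
    (forall i, P i -> [/\ P (h i), h i != i & f (h i) = f i]) ->
  \sum_(i | P i) f i = 0.
Proof.
move=> char2 hK hP.
(* In each pair {i, h i} exactly one member has the smaller rank. *)
rewrite (bigID (fun i => (enum_rank i < enum_rank (h i))%N)) /= addrC.
rewrite (reindex_inj (inv_inj hK)) /=.
rewrite -[RHS](char2 (\sum_(i | P i && (enum_rank i < enum_rank (h i))%N) f i)).
congr (_ + _); apply: eq_big => [i|i /andP[Phi _]]; last first.
  by have [_ _] := hP _ Phi; rewrite hK.
have -> : P (h i) = P i.
  by apply/idP/idP=> [/hP[]|/hP[]//]; rewrite hK.
rewrite hK; have [Pi|//] := boolP (P i).
have [_ neq _] := hP _ Pi.
rewrite -leqNgt leq_eqVlt; case: eqP => // /val_inj/enum_rank_inj eq_hi.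
by rewrite -eq_hi eqxx in neq.
Qed.

Section Restriction.

Variables (F : fieldType) (gT : finGroupType) (U E : {group gT}).
Hypothesis char2 : forall x : F, x + x = 0.
Hypotheses (abE : abelian E) (E2 : forall x, x \in E -> (x * x = 1)%g).
Local Notation cosets := (rcosets U [set: gT]).

Definition moving (A : {set gT}) := [set x in E | A :* x != A].
(** On an E-orbit that is not a point, one element of E that moves every coset
    of the orbit: moving A is constant on orbits because E is abelian. *)
Definition shift (A : {set gT}) : gT := repr (moving A).
(** Representatives compatible with the pairing of A with A :* shift A: the
    representative of one member of each pair determines the other.  This is what
    makes the two members contribute the same term to the transfer. *)
Definition pairing_repr (A : {set gT}) : gT :=
  if (enum_rank A <= enum_rank (A :* shift A))%N then repr A
  else (repr (A :* shift A) * shift A)%g.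

Lemma moving_mulg A x : x \in E -> moving (A :* x) = moving A.
Proof.
move=> xE; apply/setP=> y; rewrite !inE; have [yE|//] := boolP (y \in E).
rewrite -rcosetM -(centsP abE _ yE _ xE) rcosetM.
by rewrite (inj_eq (can_inj (rcosetK x))).
Qed.

Lemma shift_in A : shift A \in E.
Proof.
rewrite /shift; have [->|[x xA]] := set_0Vmem (moving A); first by rewrite repr_set0.
by have := mem_repr _ xA; rewrite inE => /andP[].
Qed.

Lemma shift_mulg A x : x \in E -> shift (A :* x) = shift A.
Proof. by move=> xE; rewrite /shift moving_mulg. Qed.

Lemma shiftK : involutive (fun A => A :* shift A).
Proof.
by move=> A /=; rewrite shift_mulg ?shift_in // -rcosetM E2 ?shift_in // rcoset1.
Qed.

Lemma shift_neq A : moving A != set0 -> A :* shift A != A.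
Proof.
by case/set0Pn=> x xA; have := mem_repr _ xA; rewrite inE => /andP[].
Qed.

Lemma pairing_repr_in A : A \in cosets -> pairing_repr A \in A.
Proof.
have repr_in B : B \in cosets -> repr B \in B.
  by case/rcosetsP=> x _ ->; exact: mem_repr_rcoset.
move=> AX; rewrite /pairing_repr; case: ifP => _; first exact: repr_in.
rewrite -[in X in _ \in X](shiftK A) /= mem_rcoset shift_mulg ?shift_in // mulgK.
by rewrite repr_in // rcosets_mulg.
Qed.

Lemma pairing_repr_shift A : moving A != set0 ->
  pairing_repr (A :* shift A) = (pairing_repr A * shift A)%g.
Proof.
move=> /shift_neq neqA; rewrite /pairing_repr (shiftK A) shift_mulg ?shift_in //.
case: leqP => [le1|lt1]; last by rewrite (ltnW lt1).
case: leqP => [le2|_]; last by rewrite -mulgA E2 ?shift_in // mulg1.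
have /val_inj/enum_rank_inj eqA : val (enum_rank A) = val (enum_rank (A :* shift A)).
  by apply/eqP; rewrite eqn_leq le2.
by rewrite -eqA eqxx in neqA.
Qed.

Lemma shift_comm A x : x \in E -> A :* shift A :* x = A :* x :* shift (A :* x).
Proof.
by move=> xE; rewrite shift_mulg // -!rcosetM (centsP abE _ (shift_in A) _ xE).
Qed.

Lemma cosetcocycle_shift A x : moving A != set0 -> x \in E ->
  cosetcocycle pairing_repr (A :* shift A) x = cosetcocycle pairing_repr A x.
Proof.
move=> mA xE; rewrite /cosetcocycle shift_comm // !pairing_repr_shift ?moving_mulg //.
rewrite shift_mulg // invMg !mulgA -(mulgA _ _ x) (centsP abE _ (shift_in A) _ xE).
by rewrite mulgA mulgK.
Qed.

(** The shift element commutes with E and is absorbed by the representatives, so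
    the path from A :* shift A has the same U-components as the path from A. *)
Lemma coset_tuple_shift A n (g : {ffun 'I_n -> gT}) :
    moving A != set0 -> (forall i, g i \in E) ->
  coset_tuple pairing_repr (A :* shift A) g = coset_tuple pairing_repr A g.
Proof.
move=> mA gE; apply/ffunP=> i; rewrite !ffunE shift_comm ?pprod_group //.
by rewrite cosetcocycle_shift ?moving_mulg ?pprod_group.
Qed.

Lemma moving0_mulg A x : moving A = set0 -> x \in E -> A :* x = A.
Proof.
by move=> mA xE; apply/eqP; move/setP/(_ x): mA; rewrite !inE xE => /negbFE.
Qed.

Lemma coset_tuple_fixed r A n (g : {ffun 'I_n -> gT}) :
    moving A = set0 -> (forall i, g i \in E) ->
  coset_tuple r A g = [ffun i => (g i ^ (r A)^-1)%g].
Proof.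
move=> mA gE; apply/ffunP=> i; rewrite !ffunE /cosetcocycle.
by rewrite !(moving0_mulg mA) ?pprod_group // /conjg invgK !mulgA.
Qed.

Definition fixed_cosets := [set A in cosets | moving A == set0].

(** The double coset formula for an elementary abelian 2-subgroup, as an equality
    of cochains: transfers from proper subgroups of E have disappeared. *)
Lemma transfer_restrict n (c : cochain F gT n) (g : {ffun 'I_n -> gT}) :
    (forall i, g i \in E) ->
  transfer U pairing_repr c g =
    \sum_(A in fixed_cosets) (c [ffun i => (g i ^ (pairing_repr A)^-1)%g] : F).
Proof.
move=> gE; rewrite ffunE (bigID (fun A => moving A == set0)) /=.
rewrite [X in _ + X](@sum_involution _ F _ (fun A => A :* shift A)) ?addr0 //.
- apply: eq_big => [A|A]; first by rewrite inE.
  by case/andP=> _ /eqP mA; rewrite coset_tuple_fixed.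
- exact: shiftK.
move=> A /andP[AX mA]; rewrite rcosets_mulg // moving_mulg ?shift_in // mA.
by rewrite shift_neq // coset_tuple_shift.
Qed.

Lemma card_fixed_cosets : odd #|[set: gT] : U| -> odd #|fixed_cosets|.
Proof.
have : #|cosets|%:R = #|fixed_cosets|%:R :> 'F_2.
  rewrite -!sum1_card !natr_sum (bigID (fun A => moving A == set0)) /=.
  rewrite [X in _ + X](@sum_involution _ _ _ (fun A => A :* shift A)) ?addr0.
  - by apply: eq_bigl => A; rewrite inE.
  - exact: F2_addxx.
  - exact: shiftK.
  move=> A /andP[AX mA]; rewrite rcosets_mulg // moving_mulg ?shift_in // mA.
  by rewrite shift_neq.
rewrite -(Fp_nat_mod (isT : prime 2)) -[RHS](Fp_nat_mod (isT : prime 2)) !modn2.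
by rewrite /indexg; case: odd; case: odd.
Qed.

End Restriction.

(** * Determinants for symmetric trilinear maps modulo two *)

Section SymmetricTrilinear.

Variables (V : lmodType 'F_2) (W : zmodType) (Phi : V -> V -> V -> W).
Hypothesis char2 : forall w : W, w + w = 0.
Hypothesis PhiD : forall u v x y, Phi (u + v) x y = Phi u x y + Phi v x y.
Hypothesis PhiC12 : forall x y z, Phi x y z = Phi y x z.
Hypothesis PhiC23 : forall x y z, Phi x y z = Phi x z y.

Definition phi (v : 'I_3 -> V) := Phi (v 0) (v 1) (v 2).

Lemma Phi_sum n (f : 'I_n -> V) x y : Phi (\sum_i f i) x y = \sum_i Phi (f i) x y.
Proof.
have Phi0 : Phi 0 x y = 0.
  by apply: (addIr (Phi 0 x y)); rewrite -PhiD !add0r.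
by apply: (big_morph (fun u => Phi u x y)) => // u v; apply: PhiD.
Qed.

(** W carries no scalars, so a scalar in F_2 acts through its representative in
    {0, 1}. *)
Lemma PhiZ (a : 'F_2) u x y : Phi (a *: u) x y = Phi u x y *+ a.
Proof.
have := Phi_sum (fun _ : 'I_a => u) x y.
by rewrite !sumr_const !card_ord -scaler_nat natr_Zp.
Qed.

Lemma Phi_sumZ n (a : 'I_n -> 'F_2) (f : 'I_n -> V) x y :
  Phi (\sum_i a i *: f i) x y = \sum_i Phi (f i) x y *+ a i.
Proof. by rewrite Phi_sum; apply: eq_bigr => i _; rewrite PhiZ. Qed.

Lemma phi_perm (s : 'S_3) v : phi (v \o s) = phi v.
Proof.
have s01 : s 0 != s 1 by rewrite (inj_eq perm_inj).
have s02 : s 0 != s 2 by rewrite (inj_eq perm_inj).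
have s12 : s 1 != s 2 by rewrite (inj_eq perm_inj).
have ordE (i : 'I_3) : [|| i == 0, i == 1 | i == 2] by case: i => [[|[|[|]]]].
rewrite /phi /=; move: s01 s02 s12.
have /or3P[/eqP->|/eqP->|/eqP->] := ordE (s 0);
have /or3P[/eqP->|/eqP->|/eqP->] := ordE (s 1);
have /or3P[/eqP->|/eqP->|/eqP->] := ordE (s 2); rewrite ?eqxx // => _ _ _.
- by rewrite PhiC23 PhiC12.
- by rewrite PhiC12 PhiC23.
- by rewrite PhiC12 PhiC23 PhiC12.
Qed.

(** The Leibniz formula with Phi for the product; 2 = 0 in W, whence no signs. *)
Definition symdet (X : 'I_3 -> 'I_3 -> V) :=
  \sum_(s : 'S_3) phi (fun i => X i (s i)).

(** Symmetry of Phi lets the three factors be reordered by their column index. *)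
Lemma symdet_tr X : symdet (fun i j => X j i) = symdet X.
Proof.
rewrite /symdet (reindex_inj invg_inj); apply: eq_bigr => s _.
by rewrite -(phi_perm s) /phi /= !permK.
Qed.

Lemma symdet_row_perm X (t : 'S_3) : symdet (fun i => X (t i)) = symdet X.
Proof.
rewrite /symdet (reindex_inj (mulgI t)); apply: eq_bigr => s _.
by rewrite -[RHS](phi_perm t) /phi /= !permM.
Qed.

(** Transposing the equal rows permutes the terms without fixed point, and
    symmetry of Phi makes paired terms equal; signs do not matter modulo 2. *)
Lemma symdet_alternate X i j : i != j -> X i = X j -> symdet X = 0.
Proof.
move=> neq_ij eqX; apply: (sum_involution (h := fun s => tperm i j * s)%g) => // s.
  by rewrite mulgA tperm2 mul1g.
move=> _; split=> //.
  apply: contraNneq neq_ij => /(canRL (mulgK s)).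
  by rewrite mulgV => /(congr1 (fun u : 'S_3 => u i)); rewrite tpermL perm1 => ->.
rewrite -(phi_perm (tperm i j)) /phi /= !permM.
have eqXt l : X (tperm i j l) = X l by case: tpermP => // ->.
by rewrite !tpermK !eqXt.
Qed.

Lemma big_ffun3 (H : 'I_3 -> 'I_3 -> 'I_3 -> W) :
  \sum_i \sum_j \sum_k H i j k = \sum_(f : {ffun 'I_3 -> 'I_3}) H (f 0) (f 1) (f 2).
Proof.
under eq_bigr do rewrite pair_big /=.
rewrite pair_big /=.
pose g (p : 'I_3 * ('I_3 * 'I_3)) :=
  [ffun i : 'I_3 => if i == 0 then p.1 else if i == 1 then p.2.1 else p.2.2].
pose h (f : {ffun 'I_3 -> 'I_3}) := (f 0, (f 1, f 2)).
rewrite (reindex h) //; exists g => [f _|[i [j k]] _]; last by rewrite /h !ffunE.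
apply/ffunP=> i; rewrite ffunE.
by case: i => [[|[|[|]]] i3] //=; congr (f _); apply: val_inj.
Qed.

(** Multiplicativity of the determinant.  Expanding by multilinearity gives a sum
    over all maps f of row indices; those that are not injective give 0 by
    symdet_alternate, and the permutations give together \det A = 1 times the
    original. *)
Lemma symdet_mull (A : 'M['F_2]_3) X : A \in unitmx ->
  symdet (fun i j => \sum_k A i k *: X k j) = symdet X.
Proof.
move=> unitA; pose w i j k := muln (muln (A 0 i) (A 1 j)) (A 2 k).
pose m (f : {ffun 'I_3 -> 'I_3}) := w (f 0) (f 1) (f 2).
transitivity (\sum_(f : {ffun 'I_3 -> 'I_3}) symdet (fun i => X (f i)) *+ m f).
  rewrite /symdet; under [RHS]eq_bigr do rewrite -sumrMnl.
  rewrite exchange_big; apply: eq_bigr => s _.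
  rewrite -(big_ffun3 (fun i j k => Phi (X i (s 0)) (X j (s 1)) (X k (s 2)) *+
    w i j k)) /phi /= Phi_sumZ; apply: eq_bigr => i _.
  rewrite PhiC12 Phi_sumZ -sumrMnl; apply: eq_bigr => j _.
  rewrite PhiC12 PhiC23 PhiC12 Phi_sumZ -!sumrMnl; apply: eq_bigr => k _.
  rewrite PhiC12 PhiC23 -!mulrnA; congr (_ *+ _).
  by rewrite mulnCA mulnC [RHS]mulnC mulnA.
rewrite (bigID (fun f : {ffun 'I_3 -> 'I_3} => injectiveb f)) /= addrC.
rewrite big1 ?add0r; last first.
  move=> f /injectivePn[i [j neq_ij eq_f]].
  by rewrite (symdet_alternate neq_ij) ?mul0rn //= eq_f.
rewrite (reindex (@pval _)) /=; last first.
  pose in_Sn := insubd (1%g : 'S_3).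
  by exists in_Sn => /= f Uf; first apply: val_inj; apply: insubdK.
transitivity (\sum_(s : 'S_3) symdet X *+ m (pval s)).
  apply: eq_big => /= [s|s _]; first exact: (valP s).
  rewrite -(symdet_row_perm X s); congr (_ *+ _).
  by apply: eq_bigr => t _; rewrite !pvalE.
rewrite sumrMnr.
have odd_det : (\sum_(s : 'S_3) m (pval s))%:R = 1 :> 'F_2.
  transitivity (\det A); last first.
    move: unitA; rewrite unitmxE unitfE; move: (\det A) => d.
    by case: d => [[|[|]]] //= *; apply: val_inj.
  rewrite natr_sum; apply: eq_bigr => s _.
  rewrite F2_opp expr1n mul1r /m /w !natrM !natr_Zp !pvalE.
  rewrite !big_ord_recl big_ord0 mulr1 mulrA.
  by congr (_ * A _ (s _) * A _ (s _)); apply: val_inj.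
have odd_m : odd (\sum_(s : 'S_3) m (pval s)).
  by move: odd_det; rewrite -(Fp_nat_mod (isT : prime 2)) modn2; case: odd => // /eqP.
rewrite -(odd_double_half (\sum_(s : 'S_3) m (pval s))%N) odd_m.
by rewrite mulrnDr -mul2n mulrnA mulr2n char2 mul0rn addr0.
Qed.

End SymmetricTrilinear.

(** * Triple cup products of degree one classes *)

Section TripleProducts.

Variable gT : finGroupType.
Local Notation F2 := 'F_2.
Local Notation coc := (cocycle F2 gT).

Definition cup3 (a b c : coc 1) : coc 3 := cup_cocycle a (cup_cocycle b c).

Lemma cup3E a b c (g : {ffun 'I_3 -> gT}) :
  vsval (cup3 a b c) g =
    vsval a [ffun=> g 0] * (vsval b [ffun=> g 1] * vsval c [ffun=> g 2]) :> F2.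
Proof.
rewrite ffunE ffunE; congr (vsval a _ * (vsval b _ * vsval c _));
  apply/ffunP=> i; rewrite !ffunE (ord1 i); congr (g _); exact: val_inj.
Qed.

Lemma cobound1 (c : cochain F2 gT 1) (g : {ffun 'I_2 -> gT}) :
  cobound c g = c [ffun=> g 1] + (c [ffun=> (g 0%R * g 1%R)%g] + c [ffun=> g 0]).
Proof.
rewrite ffunE !big_ord_recl big_ord0 addr0 !F2_opp !expr1n !scale1r.
congr (c _ + (c _ + c _)); apply/ffunP=> i; rewrite !ffunE (ord1 i) /=;
  first [by congr (g _); apply: val_inj | by congr (g _ * g _)%g; apply: val_inj].
Qed.

Lemma cocycle1M (a : coc 1) x y :
  vsval a [ffun=> (x * y)%g] = vsval a [ffun=> x] + vsval a [ffun=> y] :> F2.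
Proof.
have := cobound1 (vsval a) [ffun i : 'I_2 => if i == 0 then x else y].
rewrite coboundP !ffunE /= => sum0; apply/eqP.
by rewrite -subr_eq0 F2_opp addrA addrC -sum0.
Qed.

Lemma cup11E (a b : cochain F2 gT 1) (g : {ffun 'I_2 -> gT}) :
  cup_cochain a b g = a [ffun=> g 0] * b [ffun=> g 1] :> F2.
Proof.
rewrite ffunE; congr (a _ * b _); apply/ffunP=> i; rewrite !ffunE (ord1 i);
  congr (g _); exact: val_inj.
Qed.

(** The difference is the coboundary of the pointwise product, that is of the
    cup-1 product. *)
Lemma cup_comm (a b : coc 1) :
  cup_cochain (vsval a) (vsval b) - cup_cochain (vsval b) (vsval a)
    \in coboundaries F2 gT 2.
Proof.
apply/coboundariesP.
exists [ffun g : {ffun 'I_1 -> gT} => vsval a g * vsval b g : F2].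
apply/ffunP=> g; rewrite cobound1 [LHS]ffunE [X in _ + X]ffunE !cup11E !ffunE.
rewrite !cocycle1M.
move: (vsval a _ : F2) (vsval a _ : F2) (vsval b _ : F2) (vsval b _ : F2) => x y z t.
have two0 : 1 + 1 = 0 :> F2 by exact: F2_addxx.
rewrite F2_opp; ring: two0.
Qed.

Definition cupclass3 a b c := cclass (cup3 a b c).

Lemma cupclass3C12 a b c : cupclass3 a b c = cupclass3 b a c.
Proof.
apply/eqP; rewrite cclass_eq.
have := cup_coboundaries_l c (cup_comm a b).
set w := cup_cochain _ _; suff -> : w = vsval (cup3 a b c) - vsval (cup3 b a c) by [].
apply/ffunP=> g; rewrite [RHS]ffunE [X in _ = _ + X]ffunE !cup3E.
rewrite ffunE [X in X * _]ffunE [X in (_ + X) * _]ffunE !cup11E mulrBl -!mulrA !ffunE.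
have -> : @lshift 2 1 0 = 0 :> 'I_3 by apply: val_inj.
have -> : @lshift 2 1 1 = 1 :> 'I_3 by apply: val_inj.
suff -> : [ffun i : 'I_1 => g (@rshift 2 1 i)] = [ffun=> g 2] by [].
by apply/ffunP=> i; rewrite !ffunE (ord1 i); congr (g _); apply: val_inj.
Qed.

Lemma cupclass3C23 a b c : cupclass3 a b c = cupclass3 a c b.
Proof.
apply/eqP; rewrite cclass_eq.
have := cup_coboundaries_r a (cup_comm b c).
set w := cup_cochain _ _; suff -> : w = vsval (cup3 a b c) - vsval (cup3 a c b) by [].
apply/ffunP=> g; rewrite ffunE [X in _ * X]ffunE [X in _ * (_ + X)]ffunE mulrBr.
by rewrite [RHS]ffunE [X in _ = _ + X]ffunE; congr (_ - _); rewrite [RHS]ffunE.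
Qed.

Lemma cupclass3D a a' b c :
  cupclass3 (a + a') b c = cupclass3 a b c + cupclass3 a' b c.
Proof.
rewrite /cupclass3 -raddfD; congr cclass; apply: val_inj; apply/ffunP=> g.
by rewrite !ffunE mulrDl.
Qed.

Lemma cohomology_char2 n (x : cohomology F2 gT n) : x + x = 0.
Proof.
rewrite -[x]reprK -raddfD -[RHS](raddf0 (@cclass F2 gT n)); congr cclass.
by apply: val_inj; apply/ffunP=> g; rewrite !ffunE F2_addxx.
Qed.

End TripleProducts.

Section PullbackSymdet.

Variables (aT rT : finGroupType) (f : {multiplicative aT -> rT}).
Local Notation F2 := 'F_2.

Lemma pullbackD n (x y : cohomology F2 rT n) :
  pullback f (x + y) = pullback f x + pullback f y.
Proof.
rewrite -[x]reprK -[y]reprK -!/(cclass _) -raddfD !pullback_cclass -raddfD.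
by congr cclass; apply: val_inj; apply/ffunP=> g; rewrite !ffunE.
Qed.

Lemma pullback_cupclass3 a b c :
  pullback f (cupclass3 a b c) =
    cupclass3 (pullback_cocycle f a) (pullback_cocycle f b) (pullback_cocycle f c).
Proof.
rewrite /cupclass3 pullback_cclass; congr cclass; apply: val_inj; apply/ffunP=> g.
rewrite ffunE !cup3E !ffunE.
by congr (vsval a _ * (vsval b _ * vsval c _)); apply/ffunP=> i; rewrite !ffunE.
Qed.

Lemma pullback_symdet X :
  pullback f (symdet (@cupclass3 rT) X) =
    symdet (@cupclass3 aT) (fun i j => pullback_cocycle f (X i j)).
Proof.
have pb0 : pullback f (0 : cohomology F2 rT 3) = 0.
  by apply: (addIr (pullback f 0)); rewrite -pullbackD !add0r.
rewrite /symdet (big_morph _ (@pullbackD 3) pb0).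
by apply: eq_bigr => s _; apply: pullback_cupclass3.
Qed.

End PullbackSymdet.

(** * Invariance of the determinant class *)

Section Invariance.

Local Notation F2 := 'F_2.
Local Notation M := M33_group.

Definition xcocycle i j : cocycle F2 (subg_of M) 1 :=
  Subvs (hom_cocycle_subproof (entryM i j)).

Lemma xcocycleE i j g : vsval (xcocycle i j) g = entry i j (g ord0).
Proof. by rewrite ffunE. Qed.

Lemma det3E : det3 = symdet (@cupclass3 (subg_of M)) xcocycle.
Proof.
apply: eq_bigr => s _; rewrite /xclass /hom_class.
rewrite (cup_cclass (xcocycle 1 (s 1))) (cup_cclass (xcocycle 0 (s 0))).
case: odd_perm => //; rewrite (_ : (-1) ^+ true = -1 :> int) // mulrN1z.
by apply/eqP; rewrite eq_sym -addr_eq0 cohomology_char2.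
Qed.

Lemma symdet_row (A : 'M[F2]_3) X : A \in unitmx ->
  symdet (@cupclass3 (subg_of M)) (fun i j => \sum_k A i k *: X k j) =
    symdet (@cupclass3 (subg_of M)) X.
Proof.
apply: symdet_mull; first exact: cohomology_char2.
- exact: cupclass3D.
- exact: cupclass3C12.
- exact: cupclass3C23.
Qed.

Lemma symdet_trM X :
  symdet (@cupclass3 (subg_of M)) (fun i j => X j i) =
    symdet (@cupclass3 (subg_of M)) X.
Proof. by apply: symdet_tr; [exact: cupclass3C12 | exact: cupclass3C23]. Qed.

Lemma eq_symdet X Y : (forall i j, X i j = Y i j) ->
  symdet (@cupclass3 (subg_of M)) X = symdet (@cupclass3 (subg_of M)) Y.
Proof. by move=> eqXY; apply: eq_bigr => s _; rewrite /phi !eqXY. Qed.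

(** Pulling back along block_conj A B replaces the matrix of classes x by
    A^-1 x B: a row operation and, after transposition, another one. *)
Lemma det3_invariant A B : pullback (block_conj A B) det3 = det3.
Proof.
rewrite det3E pullback_symdet.
pose Y k j := \sum_l (GLval B)^T j l *: xcocycle k l.
transitivity (symdet (@cupclass3 (subg_of M))
                (fun i j => \sum_k GLval A^-1 i k *: Y k j)); last first.
  rewrite symdet_row; last exact: (GL_unitmx A^-1%g).
  rewrite -symdet_trM -[RHS]symdet_trM.
  rewrite (@symdet_row (GLval B)^T (fun l k => xcocycle k l)) //.
  by rewrite unitmx_tr; exact: (GL_unitmx B).
apply: eq_symdet => i j; apply: val_inj; apply/ffunP=> g.
rewrite ffunE xcocycleE ffunE entry_block_conj mxE.
under eq_bigr do rewrite mxE mulr_suml.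
rewrite exchange_big linear_sum sum_ffunE; apply: eq_bigr => k _.
rewrite linearZ /= ffunE /Y linear_sum sum_ffunE scaler_sumr; apply: eq_bigr => l _.
rewrite linearZ /= [in RHS]ffunE !mxE xcocycleE.
by rewrite -mulrA [entry k l _ * _]mulrC.
Qed.

End Invariance.

(** * Deciding identities between Boolean polynomials *)

(** Boolean polynomials as decision trees on the variables in order: at depth n,
    BNode p0 p1 stands for p0 + x_n p1.  The idempotence of F_2 is built in, so the
    only tree in normal form that represents the zero function is BConst false. *)
Inductive bpoly := BConst of bool | BNode of bpoly & bpoly.

Fixpoint beval (e : nat -> 'F_2) n (p : bpoly) : 'F_2 :=
  match p with
  | BConst b => b%:R
  | BNode p0 p1 => beval e n.+1 p0 + e n * beval e n.+1 p1
  end.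

Definition bnode p0 p1 :=
  match p0, p1 with
  | BConst _, BConst false => p0
  | _, _ => BNode p0 p1
  end.

Fixpoint baddc b p :=
  match p with
  | BConst b' => BConst (b (+) b')
  | BNode p0 p1 => bnode (baddc b p0) p1
  end.

Fixpoint badd p q :=
  match p, q with
  | BConst b, _ => baddc b q
  | _, BConst b => baddc b p
  | BNode p0 p1, BNode q0 q1 => bnode (badd p0 q0) (badd p1 q1)
  end.

Fixpoint bmul p q :=
  match p, q with
  | BConst b, _ => if b then q else p
  | _, BConst b => if b then p else q
  | BNode p0 p1, BNode q0 q1 =>
      bnode (bmul p0 q0) (badd (bmul p0 q1) (bmul p1 (badd q0 q1)))
  end.

Fixpoint bvar n :=
  if n is m.+1 then BNode (bvar m) (BConst false)
  else BNode (BConst false) (BConst true).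

Lemma beval_node e n p0 p1 :
  beval e n (bnode p0 p1) = beval e n.+1 p0 + e n * beval e n.+1 p1.
Proof. by case: p0 => [b|? ?]; case: p1 => [[]|? ?] //=; rewrite mulr0 addr0. Qed.

Lemma natr_addb (b c : bool) : (b (+) c)%:R = b%:R + c%:R :> 'F_2.
Proof. by apply: val_inj; case: b c => [[]|[]]. Qed.

Lemma beval_addc e n b p : beval e n (baddc b p) = b%:R + beval e n p.
Proof.
elim: p n => [c|p0 IH0 p1 IH1] n /=; first by rewrite natr_addb.
by rewrite beval_node IH0 addrA.
Qed.

Lemma beval_add e n p q : beval e n (badd p q) = beval e n p + beval e n q.
Proof.
elim: p q n => [b|p0 IH0 p1 IH1] q n; first by rewrite /= beval_addc.
case: q => [b|q0 q1].
  by rewrite -[badd _ _]/(baddc b (BNode p0 p1)) beval_addc addrC.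
by rewrite beval_node IH0 IH1 mulrDr addrACA.
Qed.

Lemma beval_mul e n p q : beval e n (bmul p q) = beval e n p * beval e n q.
Proof.
elim: p q n => [[] |p0 IH0 p1 IH1] q n; rewrite ?mul1r ?mul0r //.
case: q => [[]|q0 q1]; rewrite /= ?mulr1 ?mulr0 //.
rewrite beval_node !beval_add !IH0 IH1 beval_add.
move: (e n) (F2_mulxx (e n)) => x xx.
by rewrite -[X in _ + X * _]xx; ring: xx.
Qed.

Inductive bexp := EVar of nat | EAdd of bexp & bexp | EMul of bexp & bexp.

Fixpoint eeval (e : nat -> 'F_2) (t : bexp) : 'F_2 :=
  match t with
  | EVar i => e i
  | EAdd t u => eeval e t + eeval e u
  | EMul t u => eeval e t * eeval e u
  end.

Fixpoint bnorm t :=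
  match t with
  | EVar i => bvar i
  | EAdd t u => badd (bnorm t) (bnorm u)
  | EMul t u => bmul (bnorm t) (bnorm u)
  end.

Lemma beval_var e i n : beval e n (bvar i) = e (n + i)%N.
Proof.
elim: i n => [|i IH] n /=; first by rewrite add0r mulr1 addn0.
by rewrite IH mulr0 addr0 addnS.
Qed.

Lemma beval_norm e t : beval e 0 (bnorm t) = eeval e t.
Proof.
elim: t => [i|t IHt u IHu|t IHt u IHu] //=; first exact: beval_var.
- by rewrite beval_add IHt IHu.
- by rewrite beval_mul IHt IHu.
Qed.

Definition bnull t := if bnorm t is BConst false then true else false.

Lemma eeval0 e t : bnull t -> eeval e t = 0.
Proof. by rewrite /bnull -beval_norm; case: bnorm => [[]|]. Qed.

(** * An explicit cocycle on the unitriangular group *)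

Section Cocycle.

Local Open Scope nat_scope.
Variables (T : Type) (add mul : T -> T -> T).
Local Infix "+" := add.
Local Infix "*" := mul.
Implicit Types (u v : nat -> T) (g h k l : nat -> nat -> T).

(** The entry above the diagonal of a product of unitriangular matrices.  All
    formulas in this section are generic in the coefficients, so that they can be
    read both in F_2 and as formal expressions. *)
Definition uprod g h (i j : nat) : T :=
  foldr (fun m s => g i m * h m j + s) (g i j + h i j) (iota i.+1 (j - i.+1)).

Definition dot u v := u 0 * v 0 + u 1 * v 1 + u 2 * v 2.

Definition cross u v (i : nat) :=
  match i with
  | 0 => u 1 * v 2 + u 2 * v 1
  | 1 => u 0 * v 2 + u 2 * v 0
  | _ => u 0 * v 1 + u 1 * v 0
  end.

(** The gradient of the cubic form u_0 u_1 u_2. *)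
Definition grad u (i : nat) :=
  match i with
  | 0 => u 1 * u 2
  | 1 => u 0 * u 2
  | _ => u 0 * u 1
  end.

(** The action of the top left block of g on vectors of length 3. *)
Definition uact g v (i : nat) : T :=
  foldr (fun j y => g i j * v j + y) (v i) (iota i.+1 (2 - i)).

(** The columns of the top right blocks of h and k are moved by the top left blocks
    of the elements before them, which accounts for c', d' and e''; p, q and s are
    the entries of the inverse of the top left block of g, and likewise p', q' for
    h.  The terms cross c d' make up det(c, d', e''); all others contain an entry
    that vanishes on the block unipotent matrices. *)
Definition det_cocycle g h k : T :=
  let p := g 0 1 in
  let q := g 0 1 * g 1 2 + g 0 2 in
  let s := g 1 2 in
  let c i := g i 3 in
  let d i := g i 4 in
  let p' := h 0 1 in
  let q' := h 0 1 * h 1 2 + h 0 2 in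
  let b' := h 3 4 in
  let c' := uact g (h^~ 3) in
  let d' := uact g (h^~ 4) in
  let e'' := uact g (uact h (k^~ 5)) in
  let w i :=
    cross c d' i + b' * grad c i +
    match i with
    | 0 => b' * c 1
    | 1 => p * (p' + c' 1 + c' 2 + d' 1) + q * (c' 2 + d' 2)
    | _ => b' * c 0 + q * (q' + c' 1 + d' 1 + d' 2)
           + s * (q' + p' * q' + q * p')
    end in
  let w3 :=
    dot c (cross c' d') + dot (grad c) d' + b' * dot (grad c) c'
    + c 0 * (b' + c' 0 + c' 2 + d' 2 + b' * c' 2)
    + c 1 * (d' 0 + b' * c' 0)
    + p * (c' 1 + c' 0 * c' 1 + c' 1 * c' 2 + c' 1 * d' 1)
    + p * q * (c' 1 * c' 2)
    + q * (c' 0 * c' 2 + c' 1 * c' 2 + c' 1 * d' 2 + c' 2 * d' 2 + c' 2 * d' 1) in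
  let w4 :=
    dot c (grad d') + b' * dot (grad c) d' + d 0 * d' 0
    + b' * (c 0 * (d 0 + d' 0 + d' 2 + c 1 + c 1 * c 2) + c 1 * d' 0)
    + c 0 * d' 1
    + p * (d' 0 * d' 1) + p * q * (d' 1 * d' 2)
    + q * (d' 0 * d' 2 + d' 1 * d' 2) in
  dot w e'' + (w3 * k 3 5 + w4 * k 4 5).

Definition det_cobound g h k l : T :=
  det_cocycle h k l + (det_cocycle (uprod g h) k l + (det_cocycle g (uprod h k) l
  + (det_cocycle g h (uprod k l) + det_cocycle g h k))).

End Cocycle.

Section Extensionality.

Variables (T : Type) (add mul : T -> T -> T).
Implicit Types g h k l : nat -> nat -> T.

(** Only the entries above the diagonal are meaningful in these formulas. *)
Definition eq_upper g g' := forall i j, (i < j < 6)%N -> g i j = g' i j.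

Lemma eq_uprod g h g' h' :
  eq_upper g g' -> eq_upper h h' -> eq_upper (uprod add mul g h) (uprod add mul g' h').
Proof.
move=> Eg Eh i j lt_ij; rewrite /uprod Eg // Eh //.
have : all (fun a => i < a < j)%N (iota i.+1 (j - i.+1)).
  apply/allP=> a; rewrite mem_iota subnKC //; by case/andP: lt_ij.
case/andP: lt_ij => lt_ij lt_j.
elim: (iota _ _) => //= a s IH /andP[/andP[lt_ia lt_aj] /IH ->].
by rewrite Eg ?Eh ?lt_ia ?lt_aj ?(ltn_trans lt_aj).
Qed.

Lemma eq_det_cocycle g h k g' h' k' :
    eq_upper g g' -> eq_upper h h' -> eq_upper k k' ->
  det_cocycle add mul g h k = det_cocycle add mul g' h' k'.
Proof.
move=> Eg Eh Ek; rewrite /det_cocycle /dot /cross /grad /uact /=.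
by rewrite !Eg // !Eh // !Ek.
Qed.

Lemma eq_det_cobound g h k l g' h' k' l' :
    eq_upper g g' -> eq_upper h h' -> eq_upper k k' -> eq_upper l l' ->
  det_cobound add mul g h k l = det_cobound add mul g' h' k' l'.
Proof.
move=> Eg Eh Ek El; rewrite /det_cobound.
by congr (add _ (add _ (add _ (add _ _))));
  apply: eq_det_cocycle => //; apply: eq_uprod.
Qed.

End Extensionality.

(** Base 6 encoding, which gives distinct variables to distinct entries of the four
    matrices numbered by s. *)
Definition gvar (s i j : nat) := EVar (s * 36 + i * 6 + j)%N.
Definition generic_cobound := det_cobound EAdd EMul (gvar 0) (gvar 1) (gvar 2) (gvar 3).

(** Parametricity of det_cobound in its operations. *)
Lemma eeval_cobound e g h k l :
  eeval e (det_cobound EAdd EMul g h k l) =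
  det_cobound +%R *%R (fun i j => eeval e (g i j)) (fun i j => eeval e (h i j))
    (fun i j => eeval e (k i j)) (fun i j => eeval e (l i j)).
Proof. by []. Qed.

Lemma generic_cobound_null : bnull generic_cobound.
Proof. by vm_compute. Qed.

Lemma det_cobound0 (g : nat -> nat -> nat -> 'F_2) :
  det_cobound +%R *%R (g 0%N) (g 1%N) (g 2%N) (g 3%N) = 0.
Proof.
pose e n := g (n %/ 36)%N ((n %% 36) %/ 6)%N (n %% 6)%N.
rewrite -[RHS](eeval0 e generic_cobound_null) eeval_cobound.
have eE s : eq_upper (g s) (fun i j => e (s * 36 + i * 6 + j)%N).
  move=> i j /andP[lt_ij lt_j]; have lt_i := ltn_trans lt_ij lt_j.
  have lt36 : (i * 6 + j < 6 * 6)%N.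
    apply: (@leq_trans (i.+1 * 6)); last by rewrite leq_mul2r.
    by rewrite mulSn addnC ltn_add2r.
  rewrite /e -addnA divnMDl // modnMDl divn_small // addn0 modn_small //.
  have e36 : (s * 36 = s * 6 * 6)%N by rewrite -mulnA.
  by rewrite divnMDl // divn_small // addn0 e36 modnMDl modnMDl modn_small.
by apply: eq_det_cobound; apply: eE.
Qed.

(** * The unitriangular group *)

Section U6.

Local Notation F2 := 'F_2.
Local Notation GL6 := ({'GL_6['F_2]}).

(** Indexed by natural numbers, as the generic formulas above are. *)
Definition mxentry (g : GL6) (i j : nat) : F2 := GLval g (inord i) (inord j).

Definition U6 : {set GL6} :=
  [set g : GL6 | [forall i : 'I_6, forall j : 'I_6,
                    (j <= i)%N ==> (GLval g i j == (i == j)%:R)]].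

Lemma U6P (g : GL6) :
  reflect (forall i j, (j <= i < 6)%N -> mxentry g i j = (i == j)%:R) (g \in U6).
Proof.
rewrite inE; apply: (iffP idP) => [/forallP gU i j /andP[le_ji lt_i]|gU].
  have lt_j := leq_ltn_trans le_ji lt_i.
  have /forallP/(_ (inord j)) := gU (inord i).
  rewrite !inordK // le_ji => /eqP; rewrite /mxentry => ->.
  by rewrite -val_eqE /= !inordK.
apply/forallP=> i; apply/forallP=> j; apply/implyP=> le_ji; apply/eqP.
by have := gU i j; rewrite /mxentry !inord_val => -> //; rewrite le_ji /=.
Qed.

Lemma mxentryM g h i j : (i < 6)%N -> (j < 6)%N ->
  mxentry (g * h) i j = \sum_(0 <= k < 6) mxentry g i k * mxentry h k j.
Proof.
move=> i6 j6; rewrite /mxentry GL_ME mxE big_mkord.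
by apply: eq_bigr => k _; rewrite inord_val.
Qed.

Lemma mxentryM_U6 g h i j : g \in U6 -> h \in U6 -> (i < j < 6)%N ->
  mxentry (g * h) i j = uprod +%R *%R (mxentry g) (mxentry h) i j.
Proof.
move=> /U6P gU /U6P hU /andP[lt_ij lt_j]; have lt_i := ltn_trans lt_ij lt_j.
(* Split the sum at i and j: the outer ranges meet only zero entries. *)
rewrite mxentryM // (big_cat_nat (n := i)) ?(ltnW lt_i) //=.
rewrite big_nat big1 ?add0r; last first.
  by move=> k /= lt_ki; rewrite gU ?(ltnW lt_ki) // gtn_eqF // mul0r.
rewrite (big_cat_nat (n := j.+1)) ?(leqW (ltnW lt_ij)) //= addrC.
rewrite big_nat big1 ?add0r; last first.
  by move=> k /andP[lt_jk lt_k]; rewrite hU ?(ltnW lt_jk) // gtn_eqF // mulr0.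
rewrite big_nat_recr ?(ltnW lt_ij) //= big_ltn // (gU i i) ?leqnn // (hU j j) ?leqnn //.
rewrite !eqxx mul1r mulr1 /uprod /index_iota addrAC addrC [h in _ + h]addrC.
elim: (iota _ _) => [|k s IH] /=; first by rewrite big_nil add0r.
by rewrite big_cons -addrA IH.
Qed.

Lemma U6_group_set : group_set U6.
Proof.
apply/group_setP; split=> [|g h gU hU].
  apply/U6P=> i j /andP[le_ji lt_i]; rewrite /mxentry GL_1E mxE -val_eqE /=.
  by rewrite !inordK // (leq_ltn_trans le_ji).
move/U6P: gU => gU; move/U6P: hU => hU; apply/U6P=> i j /andP[le_ji lt_i].
have lt_j := leq_ltn_trans le_ji lt_i.
rewrite mxentryM // (bigD1_seq i) ?mem_index_iota ?iota_uniq //=.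
rewrite gU ?leqnn // eqxx mul1r hU ?le_ji // big1_seq ?addr0 // => k.
move=> /andP[neq_ki]; rewrite mem_index_iota => lt_k.
case: (ltngtP k i) neq_ki => [lt_ki|gt_ki|//] _.
  by rewrite gU ?(ltnW lt_ki) // gtn_eqF // mul0r.
rewrite hU ?(leq_trans le_ji (ltnW gt_ki)) // gtn_eqF ?mulr0 //.
exact: leq_ltn_trans le_ji gt_ki.
Qed.

Canonical U6_group := Group U6_group_set.

Lemma card_U6 : #|U6| = (2 ^ 15)%N.
Proof.
pose S (p : 'I_6 * 'I_6) : {pred F2} :=
  [pred x | (p.2 <= p.1)%N ==> (x == (p.1 == p.2)%:R)].
have unitU (f : {ffun 'I_6 * 'I_6 -> F2}) : f \in family S ->
    (\matrix_(i, j) f (i, j) : 'M_6) \is a GRing.unit.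
  move/familyP=> fS.
  rewrite [_ \is a _](_ : _ = (\matrix_(i, j) f (i, j) \in unitmx)) //.
  rewrite unitmxE -det_tr det_trig.
    rewrite big1 ?unitr1 // => i _; rewrite !mxE; have := fS (i, i).
    by rewrite !inE /= leqnn eqxx => /eqP.
  apply/is_trig_mxP=> i j lt_ij; rewrite !mxE; have := fS (j, i).
  by rewrite !inE /= (ltnW lt_ij) /= => /eqP->; rewrite -val_eqE gtn_eqF.
pose phi (f : {ffun 'I_6 * 'I_6 -> F2}) : GL6 :=
  insubd (1%g : GL6) (\matrix_(i, j) f (i, j) : 'M_6).
have phiE f : f \in family S -> GLval (phi f) = \matrix_(i, j) f (i, j).
  by move=> fS; rewrite -[GLval _]/(val (phi f)) val_insubd unitU.
have <- : phi @: family S = U6.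
  apply/setP=> g; apply/imsetP/idP=> [[f fS ->]|].
    rewrite inE; apply/forallP=> i; apply/forallP=> j; apply/implyP=> le_ji.
    rewrite phiE // mxE; have /familyP/(_ (i, j)) := fS.
    by rewrite inE /= le_ji.
  rewrite inE => /forallP gU; exists [ffun p => GLval g p.1 p.2].
    by apply/familyP=> -[i j]; rewrite inE /= ffunE; have /forallP := gU i.
  apply: val_inj; rewrite /= -[RHS]/(GLval _) phiE.
    by apply/matrixP=> i j; rewrite mxE ffunE.
  by apply/familyP=> -[i j]; rewrite inE /= ffunE; have /forallP := gU i.
rewrite card_in_imset => [|f f' fS f'S eq_phi]; last first.
  apply/ffunP=> -[i j]; have := phiE f fS; rewrite eq_phi phiE //.
  by move/matrixP/(_ i j); rewrite !mxE.
rewrite card_family foldrE big_image -(pair_bigA _ (fun i j => #|S (i, j)|)) /=.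
have cardS (i j : 'I_6) : #|S (i, j)| = if (j <= i)%N then 1%N else 2.
  case: ifP => le_ji.
    transitivity #|pred1 ((i == j)%:R : F2)|; last exact: card1.
    by apply: eq_card => x; rewrite !inE /= le_ji.
  transitivity #|{: F2}|; last exact: card_Fp.
  by apply: eq_card => x; rewrite !inE /= le_ji.
under eq_bigr do under eq_bigr do rewrite cardS.
by rewrite !big_ord_recl !big_ord0.
Qed.

(** U6 has order 2 ^ 15, the 2-part of the order of GL_6(F_2). *)
Lemma odd_index_U6 : odd #|[set: GL6] : U6|.
Proof.
have := logn_card_GL_p 6 (isT : prime 2).
rewrite -[#|_|](Lagrange (subsetT U6_group)) lognM ?cardG_gt0 ?indexg_gt0 //=.
rewrite card_U6 lognX /= -[RHS]addn0 => /addnI idx0.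
rewrite -[odd _]negbK -dvdn2 (pfactor_dvdn 1 (isT : prime 2)) ?indexg_gt0 //.
by rewrite [logn _ _]idx0.
Qed.

End U6.

(** * The cosets fixed by the block unipotent subgroup *)

Section FixedCosets.

Local Notation F2 := 'F_2.
Local Notation GL6 := ({'GL_6['F_2]}).
Local Notation GL3 := ({'GL_3['F_2]}).
Local Notation M := M33_group.

Definition det_cochain : cochain F2 GL6 3 :=
  [ffun g : {ffun 'I_3 -> GL6} =>
     det_cocycle +%R *%R (mxentry (g 0)) (mxentry (g 1)) (mxentry (g 2)) : F2].

Lemma cobound_det_cochain (g : {ffun 'I_4 -> GL6}) :
  (forall i, g i \in U6) -> cobound det_cochain g = 0.
Proof.
move=> gU; rewrite ffunE !big_ord_recl big_ord0 addr0 !F2_opp !expr1n !scale1r.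
pose G s : GL6 := match s with 0%N => g 0 | 1%N => g 1 | 2%N => g 2 | _ => g 3 end.
rewrite -(det_cobound0 (fun s => mxentry (G s))) /det_cobound /G.
have eqM x y : x \in U6 -> y \in U6 ->
    eq_upper (mxentry (x * y)) (uprod +%R *%R (mxentry x) (mxentry y)).
  by move=> xU yU i j; apply: mxentryM_U6.
congr (_ + (_ + (_ + (_ + _)))); rewrite [LHS]ffunE;
  apply: eq_det_cocycle => i j lt_ij; rewrite !ffunE /=;
  match goal with
  | |- mxentry (_ * _)%g _ _ = _ =>
      rewrite eqM //; congr (uprod _ _ (mxentry (g _)) (mxentry (g _)) i j)
  | _ => congr (mxentry (g _) i j)
  end; exact: val_inj.
Qed.

Lemma unip_inj (g h : GL6) X : unip g X -> unip h X -> g = h.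
Proof.
move=> /eqP gX /eqP hX; apply: val_inj.
by rewrite /= -[LHS]/(GLval g) -[RHS]/(GLval h) gX hX.
Qed.

Lemma abelian_M : abelian M.
Proof.
apply/centsP=> x /M33P[X xX] y /M33P[Y yY].
by apply: (unip_inj (unipM xX yY)); rewrite addrC; apply: unipM.
Qed.

Lemma M_elementary x : x \in M -> (x * x = 1)%g.
Proof.
case/M33P=> X xX; apply: (unip_inj (unipM xX xX)).
rewrite (_ : X + X = 0) /unip; first by rewrite GL_1E -scalar_mx_block.
by apply/matrixP=> i j; rewrite !mxE F2_addxx.
Qed.

Lemma unip_exists X : exists2 g : GL6, g \in M & unip g X.
Proof.
have hU : (block_mx 1%:M X 0 1%:M : 'M[F2]_6) \is a GRing.unit.
  suff: (block_mx 1%:M X 0 1%:M : 'M[F2]_(3 + 3)) \in unitmx by [].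
  by rewrite unitmxE det_ublock !det1 mulr1 unitr1.
have gX : unip (FinRing.Unit hU) X by rewrite /unip.
by exists (FinRing.Unit hU) => //; apply/M33P; exists X.
Qed.

Lemma U6_dlsubmx (g : GL6) : g \in U6 -> @dlsubmx _ 3 3 3 3 (GLval g) = 0.
Proof.
rewrite inE => /forallP gU; apply/matrixP=> i j; rewrite !mxE.
have lt_ji : (lshift 3 j < rshift 3 i)%N by rewrite /= ltn_addr.
have /forallP/(_ (lshift 3 j)) := gU (rshift 3 i).
by rewrite (ltnW lt_ji) /= => /eqP->; rewrite -val_eqE gtn_eqF.
Qed.

(** Apply the hypothesis to the matrix units. *)
Lemma mulmx_sandwich0 (C C' : 'M[F2]_3) :
  (forall X, C *m X *m C' = 0) -> C = 0 \/ C' = 0.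
Proof.
move=> CXC'; have [->|C0] := eqVneq C 0; [by left | right].
have /existsP[i /existsP[k Cik]] : [exists i, exists k, C i k != 0].
  apply: contraNT C0; rewrite negb_exists => /forallP H; apply/eqP/matrixP=> i k.
  by have := H i; rewrite negb_exists => /forallP/(_ k); rewrite negbK mxE => /eqP.
apply/matrixP=> l j; have /matrixP/(_ i j) := CXC' (delta_mx k l).
rewrite mxE (bigD1 l) //= big1 ?addr0 => [|l' neq_l]; last first.
  rewrite mxE big1 ?mul0r // => k' _; rewrite mxE (negPf neq_l) andbF mulr0 //.
rewrite mxE (bigD1 k) //= big1 ?addr0 => [|k' neq_k]; last first.
  by rewrite mxE (negPf neq_k) mulr0.
by rewrite !mxE !eqxx mulr1 => /eqP; rewrite mulf_eq0 (negPf Cik) => /eqP.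
Qed.

(** If C and C' are the bottom left blocks of x and of its inverse, the bottom left
    block of the conjugate of the unipotent with block X is C X C'.  If this is 0 for
    all X, then C or C' is 0, hence both are, and x is block upper triangular. *)
Lemma conj_M_U6 (x : GL6) :
    (forall m, m \in M -> (m ^ x^-1)%g \in U6) ->
  exists A B : GL3, forall m : subg_of M,
    (sgval m ^ x^-1)%g = sgval (block_conj A B m).
Proof.
move=> xMU.
pose g : 'M[F2]_(3 + 3) := GLval x; pose g' : 'M[F2]_(3 + 3) := GLval x^-1%g.
have gg' : g *m g' = 1%:M by rewrite -[LHS](GL_MxE x x^-1%g) mulgV.
pose P := ulsubmx g; pose Q := ursubmx g; pose C := dlsubmx g; pose S := drsubmx g.
pose P' := ulsubmx g'; pose Q' := ursubmx g'.
pose C' := dlsubmx g'; pose S' := drsubmx g'.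
have gE : g = block_mx P Q C S by rewrite submxK.
have g'E : g' = block_mx P' Q' C' S' by rewrite submxK.
move: gg'; rewrite gE g'E mulmx_block scalar_mx_block => /eq_block_mx[PP' PQ' CP' CQ'].
have conjE m X : unip m X -> GLval (m ^ x^-1)%g =
    block_mx (P *m P' + (P *m X + Q) *m C') (P *m Q' + (P *m X + Q) *m S')
             (C *m P' + (C *m X + S) *m C') (C *m Q' + (C *m X + S) *m S')
      :> 'M_(3 + 3).
  move/eqP=> mX; rewrite conjgE invgK mulgA.
  transitivity (g *m (GLval m : 'M_(3 + 3)) *m g'); first by [].
  by rewrite mX gE g'E !mulmx_block !mulmx1 !mulmx0 !addr0.
have CXC' X : C *m X *m C' = 0.
  have [m mM mX] := unip_exists X; have := U6_dlsubmx (xMU m mM).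
  by rewrite (conjE _ _ mX) block_mxKdl mulmxDl addrCA CP' addr0.
have [C0 C'0] : C = 0 /\ C' = 0.
  case: (mulmx_sandwich0 CXC') => [C0|C'0]; split=> //.
    move: CP' CQ'; rewrite C0 !mul0mx !add0r => SC' SS'.
    by rewrite -[C']mul1mx -(mulmx1C SS') -mulmxA SC' mulmx0.
  move: CP' PP'; rewrite C'0 !mulmx0 !addr0 => CP' PP'.
  by rewrite -[C]mulmx1 -(mulmx1C PP') mulmxA CP' mul0mx.
move: PP' CQ'; rewrite C0 C'0 mul0mx mulmx0 addr0 add0r => PP' SS'.
have unitP : P \is a GRing.unit by exact: (proj1 (mulmx1_unit PP')).
have unitS' : S' \is a GRing.unit by exact: (proj2 (mulmx1_unit SS')).
pose A : GL3 := FinRing.Unit unitP; pose B : GL3 := FinRing.Unit unitS'.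
exists A^-1%g, B => m; have /M33P[X mX] := subgP m.
apply: (@unip_inj _ _ (P *m X *m S')); last first.
  by have := unip_conj A^-1 B mX; rewrite invgK.
apply/eqP; rewrite (conjE _ _ mX) C0 C'0 !mul0mx !mulmx0 !addr0 !add0r PP' SS'.
by rewrite mulmxDl addrCA PQ' addr0.
Qed.

Lemma F2_det2 (A : 'M[F2]_2) : \det A = A 0 0 * A 1 1 + A 0 1 * A 1 0.
Proof.
rewrite (expand_det_row _ 0) !big_ord_recl big_ord0 /cofactor !det_mx11 !mxE.
rewrite !F2_opp !expr1n !mul1r addr0.
by congr (A _ _ * A _ _ + A _ _ * A _ _); apply: val_inj.
Qed.

(** Modulo 2 the sum is a determinant, so cofactor expansion computes it; the terms
    on the right are ordered as in det_cocycle. *)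
Lemma sum_S3 (a : 'I_3 -> 'I_3 -> F2) :
  \sum_(s : 'S_3) a (s 0) 0 * (a (s 1) 1 * a (s 2) 2) =
    a 1 0 * a 2 1 * a 0 2 + a 2 0 * a 1 1 * a 0 2 + a 0 0 * a 2 1 * a 1 2
    + a 2 0 * a 0 1 * a 1 2 + a 0 0 * a 1 1 * a 2 2 + a 1 0 * a 0 1 * a 2 2.
Proof.
transitivity (\det (\matrix_(i, j) a j i)).
  apply: eq_bigr => s _; rewrite F2_opp expr1n mul1r.
  rewrite !big_ord_recl big_ord0 mulr1 !mxE.
  have e1 : lift ord0 ord0 = 1 :> 'I_3 by apply: val_inj.
  have e2 : lift ord0 (lift ord0 ord0) = 2 :> 'I_3 by apply: val_inj.
  by rewrite e1 e2.
rewrite (expand_det_row _ 0) !big_ord_recl big_ord0 /cofactor !F2_det2 !mxE.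
rewrite !F2_opp !expr1n !mul1r addr0.
(* Natural number indices make the two ways of writing an ordinal agree. *)
pose b i j := a (inord i) (inord j).
have aE i j : a i j = b (val i) (val j) by rewrite /b !inord_val.
by rewrite !aE /=; ring.
Qed.

Lemma mxentry_M (m : subg_of M) :
  eq_upper (mxentry (sgval m))
    (fun i j => if (i < 3 <= j)%N then entry (inord i) (inord (j - 3)) m else 0).
Proof.
move=> i j /andP[lt_ij lt_j]; have /M33P[X mX] := subgP m.
have lE k : (k < 3)%N -> inord k = lshift 3 (inord k : 'I_3) :> 'I_6.
  by move=> lt_k; apply: val_inj; rewrite /= !inordK // (leq_trans lt_k).
have rE k : (3 <= k < 6)%N -> inord k = rshift 3 (inord (k - 3) : 'I_3) :> 'I_6.
  move=> /andP[le_k lt_k]; apply: val_inj; rewrite /= !inordK ?subnKC //.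
  by rewrite ltn_subLR.
have mE : mxentry (sgval m) i j =
    (block_mx 1%:M X 0 1%:M : 'M_(3 + 3)) (inord i) (inord j).
  by move/eqP: mX => <-.
rewrite mE /entry (unip_ur mX) {mE}; case: (ltnP i 3) => [lt_i|le_i] /=.
  case: (leqP 3 j) => [le_j|lt_j3].
    by rewrite (lE i) // (rE j) ?le_j // block_mxEur.
  by rewrite (lE i) // (lE j) // block_mxEul mxE -val_eqE /= !inordK // ltn_eqF.
have le_j := leq_trans le_i (ltnW lt_ij).
rewrite (rE i) ?le_i ?(ltn_trans lt_ij) // (rE j) ?le_j // block_mxEdr mxE -val_eqE /=.
rewrite !inordK ?ltn_subLR // ?(ltn_trans lt_ij) //.
by rewrite ltn_eqF // ltn_sub2r // (leq_ltn_trans le_i).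
Qed.

(** The transpose of the expansion that defines det3: det_cochain is organized by
    columns of the block. *)
Definition det_cocycle_M : cocycle F2 (subg_of M) 3 :=
  \sum_(s : 'S_3) cup3 (xcocycle (s 0) 0) (xcocycle (s 1) 1) (xcocycle (s 2) 2).

Lemma det_cochain_M (g : {ffun 'I_3 -> subg_of M}) :
  det_cochain [ffun i => sgval (g i)] = vsval det_cocycle_M g.
Proof.
rewrite /det_cocycle_M linear_sum sum_ffunE.
under eq_bigr do rewrite cup3E !xcocycleE !ffunE.
rewrite (sum_S3 (fun i j => entry i j (g j))) ffunE !ffunE.
rewrite (eq_det_cocycle _ _ (@mxentry_M _) (@mxentry_M _) (@mxentry_M _)).
rewrite /det_cocycle /dot /cross /grad /uact /=.
have e0 : inord 0 = 0 :> 'I_3 by rewrite -[RHS]inord_val.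
have e1 : inord 1 = 1 :> 'I_3 by rewrite -[RHS]inord_val.
have e2 : inord 2 = 2 :> 'I_3 by rewrite -[RHS]inord_val.
rewrite !(mul0r, mulr0, add0r, addr0) !subSS !subn0 e0 e1 e2.
by rewrite !mulrDl !addrA.
Qed.

Lemma cclass_sum (F : fieldType) (gT : finGroupType) n (I : finType) (P : pred I)
    (z : I -> cocycle F gT n) :
  cclass (\sum_(i | P i) z i) = \sum_(i | P i) cclass (z i).
Proof. exact: (big_morph (@cclass F gT n) (raddfD _) (raddf0 _)). Qed.

Lemma cclass_det_cocycle_M : cclass det_cocycle_M = det3.
Proof. by rewrite det3E -symdet_trM /det_cocycle_M cclass_sum. Qed.

Lemma fixed_coset_class A : A \in fixed_cosets U6_group M ->
  exists2 z : cocycle F2 (subg_of M) 3, cclass z = det3 &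
    forall g : {ffun 'I_3 -> subg_of M},
      det_cochain [ffun i => (sgval (g i) ^ (pairing_repr M A)^-1)%g] = vsval z g.
Proof.
rewrite inE => /andP[AX /eqP mA].
have AU : A = U6_group :* pairing_repr M A.
  have := pairing_repr_in abelian_M M_elementary AX.
  by case/rcosetsP: AX => x _ -> /rcoset_eqP.
have [m mM|P [Q PQ]] := @conj_M_U6 (pairing_repr M A).
  have := moving0_mulg mA mM.
  rewrite {1 2}AU -rcosetM => /rcoset_eqP; rewrite mem_rcoset.
  by rewrite /conjg invgK mulgA.
exists (pullback_cocycle (block_conj P Q) det_cocycle_M).
  by rewrite -pullback_cclass cclass_det_cocycle_M det3_invariant.
move=> g; rewrite [RHS]ffunE -det_cochain_M; congr (det_cochain _).
by apply/ffunP=> i; rewrite !ffunE PQ.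
Qed.

Lemma det3_lifts : exists c : cohomology F2 GL6 3, restriction M c = det3.
Proof.
have UZ : transfer U6_group (pairing_repr M) det_cochain \in cocycles F2 GL6 3.
  apply: transfer_cocycle; first exact: (pairing_repr_in abelian_M M_elementary).
  exact: cobound_det_cochain.
exists (cclass (Subvs UZ)); rewrite /restriction pullback_cclass.
have exz (A : {set GL6}) : exists z : cocycle F2 (subg_of M) 3,
    A \in fixed_cosets U6_group M -> cclass z = det3 /\
    forall g : {ffun 'I_3 -> subg_of M},
      det_cochain [ffun i => (sgval (g i) ^ (pairing_repr M A)^-1)%g] = vsval z g.
  have [AX|_] := boolP (A \in fixed_cosets U6_group M); last by exists 0.
  by have [z zE zP] := fixed_coset_class AX; exists z.
have [z zP] := fin_all_exists exz.
transitivity (cclass (\sum_(A in fixed_cosets U6_group M) z A)).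
  congr cclass; apply: val_inj; apply/ffunP=> g; rewrite ffunE linear_sum sum_ffunE.
  rewrite (transfer_restrict U6_group F2_addxx abelian_M M_elementary); last first.
    by move=> i; rewrite ffunE; apply: subgP.
  apply: eq_bigr => A AX; rewrite -(proj2 (zP A AX)).
  by congr (det_cochain _); apply/ffunP=> i; rewrite !ffunE.
rewrite cclass_sum (eq_bigr (fun=> det3)) => [|A AX]; last by case: (zP A AX).
rewrite sumr_const -(odd_double_half #|_|).
rewrite (card_fixed_cosets abelian_M M_elementary odd_index_U6).
by rewrite mulrnDr -mul2n mulrnA mulr2n cohomology_char2 mul0rn addr0.
Qed.

End FixedCosets.

Theorem proposition6p8 :
  det3 \in block_invariants 3 /\
  exists c : cohomology 'F_2 {'GL_6['F_2]} 3, restriction M33_group c = det3.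
Proof.
split; last exact: det3_lifts.
by rewrite inE; apply/forallP=> A; apply/forallP=> B; rewrite det3_invariant.
Qed.
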